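(* Let $n\ge 1$ and let $(X,x)=\prod_{i\in I}(X_i,x_i)$ be the product of a family of pointed topological spaces, where each $X_i$ is second countable and each $\pi_n^{qtop}(X_i,x_i)$ is second countable and Hausdorff. Then $\pi_n^{qtop}(X,x)\cong\prod_{i\in I}\pi_n^{qtop}(X_i,x_i)$ as topological groups; that is, $\pi_n^{qtop}(X,x)$ and $\prod_{i\in I}\pi_n^{qtop}(X_i,x_i)$ (with the product topology) are topological groups and are isomorphic as such.
   Context: For a pointed space $(X,x)$, $\Omega^n(X,x)$ is the $n$th loop space, i.e. the space of continuous maps $([0,1]^n,\partial [0,1]^n)\to (X,x)$ with the compact-open topology. $\pi_n^{qtop}(X,x)$ denotes the homotopy group $\pi_n(X,x)$ endowed with the quotient topology induced by the natural surjection $q:\Omega^n(X,x)\to\pi_n(X,x)$, $f\mapsto [f]$. It is always a quasitopological group (inversion is continuous and multiplication is continuous in each variable separately), but multiplication need not be jointly continuous. The product $(X,x)$ carries the product topology and $x=(x_i)_{i\in I}$. *)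

(* Defs.v *)
From HB Require Import structures.
From mathcomp Require Import all_boot all_order all_algebra.
From mathcomp Require Import generic_quotient ring lra.
From mathcomp Require Import all_classical reals topology normedtype.
Import Order.TTheory GRing.Theory Num.Theory.
Import numFieldNormedType.Exports.

Set Implicit Arguments.
Unset Strict Implicit.
Unset Printing Implicit Defensive.

Local Open Scope classical_set_scope.
Local Open Scope ring_scope.
Local Open Scope quotient_scope.

HB.structure Definition PreTopologicalGroup := {G of Topological G & Group G}.
Notation preTopologicalGroupType := PreTopologicalGroup.type.

Definition is_topological_group (G : preTopologicalGroupType) : Prop :=
  continuous (fun p : G * G => (p.1 * p.2)%g) /\
  continuous (fun a : G => (a^-1)%g).

Definition topological_group_isomorphic (G H : preTopologicalGroupType) : Prop :=
  exists f : G -> H, exists g : H -> G,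
    [/\ {morph f : a b / (a * b)%g >-> (a * b)%g},
        cancel f g, cancel g f, continuous f & continuous g].

Section product_group.
Context {I : Type} (G : I -> preTopologicalGroupType).
Implicit Types a b c : prod_topology G.

Definition prod_one : prod_topology G := fun i => 1%g.
Definition prod_inv a : prod_topology G := fun i => ((a i)^-1)%g.
Definition prod_mul a b : prod_topology G := fun i => (a i * b i)%g.

Lemma prod_mulgA : associative prod_mul.
Proof. by move=> a b c; apply: functional_extensionality_dep => i; exact: mulgA. Qed.

Lemma prod_mul1g : left_id prod_one prod_mul.
Proof. by move=> a; apply: functional_extensionality_dep => i; exact: mul1g. Qed.

Lemma prod_mulg1 : right_id prod_one prod_mul.
Proof. by move=> a; apply: functional_extensionality_dep => i; exact: mulg1. Qed.

Lemma prod_mulVg : left_inverse prod_one prod_inv prod_mul.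
Proof. by move=> a; apply: functional_extensionality_dep => i; exact: mulVg. Qed.

Lemma prod_mulgV : right_inverse prod_one prod_inv prod_mul.
Proof. by move=> a; apply: functional_extensionality_dep => i; exact: mulgV. Qed.

HB.instance Definition _ := isGroup.Build (prod_topology G)
  prod_mulgA prod_mul1g prod_mulg1 prod_mulVg prod_mulgV.
End product_group.

Section continuity.
Context {T : topologicalType}.

Lemma continuous_compose {U V : topologicalType} (g : U -> V) (f : T -> U) :
  continuous g -> continuous f -> continuous (fun x => g (f x)).
Proof. by move=> cg cf x; apply: continuous_comp; [exact: cf|exact: cg]. Qed.

Lemma continuous_pair {U V : topologicalType} (f : T -> U) (g : T -> V) :
  continuous f -> continuous g -> continuous (fun x => (f x, g x)).
Proof. by move=> cf cg x; apply: cvg_pair; [exact: cf|exact: cg]. Qed.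

Lemma continuous_fst {U : topologicalType} : continuous (@fst T U).
Proof. by move=> x; exact: cvg_fst. Qed.

Lemma continuous_snd {U : topologicalType} : continuous (@snd U T).
Proof. by move=> x; exact: cvg_snd. Qed.

Lemma continuous_idfun : continuous (fun x : T => x).
Proof. by move=> x. Qed.

Lemma continuous_set_val (A : set T) : continuous (\val : A -> T).
Proof. exact: (@initial_continuous A T set_val). Qed.

Lemma continuous_in_set {U : topologicalType} (A : set T) (f : U -> A) :
  continuous (fun x => \val (f x)) -> continuous f.
Proof. by move=> cf; exact: (@continuous_comp_initial A U T set_val). Qed.

Lemma continuous_rV {U : topologicalType} n (f : U -> 'rV[T]_n) :
  (forall i, continuous (fun x => f x ord0 i)) -> continuous f.
Proof.
move=> cf x A [P Pfx PA].
have : \forall y \near x, forall j, P ord0 j (f y ord0 j).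
  by apply: filter_forall => j; exact/cf/Pfx.
by apply: filterS => y Py; apply: PA => i j; rewrite (ord1 i); exact: Py.
Qed.

End continuity.

Section real_continuity.
Context {R : realType} {T : topologicalType}.
Implicit Types a b : T -> R.

Lemma continuous_addr a b :
  continuous a -> continuous b -> continuous (fun x => a x + b x).
Proof. by move=> ca cb x; apply: cvgD; [exact: ca|exact: cb]. Qed.

Lemma continuous_subr a b :
  continuous a -> continuous b -> continuous (fun x => a x - b x).
Proof. by move=> ca cb x; apply: cvgB; [exact: ca|exact: cb]. Qed.

Lemma continuous_mulr a b :
  continuous a -> continuous b -> continuous (fun x => a x * b x).
Proof. by move=> ca cb x; apply: cvgM; [exact: ca|exact: cb]. Qed.

Lemma continuous_maxr a b :
  continuous a -> continuous b -> continuous (fun x => Num.max (a x) (b x)).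
Proof. by move=> ca cb x; apply: continuous_max; [exact: ca|exact: cb]. Qed.

Lemma continuous_minr a b :
  continuous a -> continuous b -> continuous (fun x => Num.min (a x) (b x)).
Proof. by move=> ca cb x; apply: continuous_min; [exact: ca|exact: cb]. Qed.

Lemma continuous_const {U : topologicalType} (u : U) : continuous (fun _ : T => u).
Proof. by move=> x; exact: cvg_cst. Qed.

Lemma continuous_glue {U : topologicalType} a (c : R) (f g : T -> U) :
  continuous a -> continuous f -> continuous g ->
  (forall x, a x = c -> f x = g x) ->
  continuous (fun x => if a x <= c then f x else g x).
Proof.
move=> ca cf cg fg x; have [axc|axc|axc] := ltgtP (a x) c.
- have ac : \forall y \near x, a y < c by exact: (ca x _ (lt_nbhsl axc)).
  rewrite /continuous_at => A; rewrite (ltW axc) => fA.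
  have fxA : \forall y \near x, A (f y) by exact: cf.
  by apply: filterS2 ac fxA => y /= ayc Afy; rewrite (ltW ayc).
- have ac : \forall y \near x, c < a y by exact: (ca x _ (lt_nbhsr axc)).
  rewrite /continuous_at => A; rewrite leNgt axc => gA.
  have gxA : \forall y \near x, A (g y) by exact: cg.
  by apply: filterS2 ac gxA => y /= ayc Agy; rewrite leNgt ayc.
- rewrite /continuous_at => A; rewrite axc lexx => fA.
  have gA : nbhs (g x) A by rewrite -fg.
  have fxA : \forall y \near x, A (f y) by exact: cf.
  have gxA : \forall y \near x, A (g y) by exact: cg.
  by apply: filterS2 fxA gxA => y /= Afy Agy; case: ifP.
Qed.

End real_continuity.

Section cube.
Context (R : realType) (n : nat).

Definition cube : set 'rV[R]_n := [set t | forall i, 0 <= t ord0 i <= 1].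

Definition coord (t : cube) (i : 'I_n) : R := \val t ord0 i.

Definition cube_boundary : set cube :=
  [set t | exists i, coord t i = 0 \/ coord t i = 1].

Lemma coord_itv (t : cube) i : 0 <= coord t i <= 1.
Proof. exact: (set_mem (valP t)). Qed.

Lemma cube_eq (t u : cube) : (forall i, coord t i = coord u i) -> t = u.
Proof.
by move=> tu; apply/val_inj/matrixP => i j; rewrite (ord1 i); exact: tu.
Qed.

Lemma continuous_coord i : continuous (coord^~ i).
Proof.
apply: (continuous_compose (g := fun v : 'rV[R]_n => v ord0 i)).
  exact: coord_continuous.
exact: continuous_set_val.
Qed.

Lemma continuous_cube {U : topologicalType} (f : U -> cube) :
  (forall i, continuous (fun x => coord (f x) i)) -> continuous f.
Proof. by move=> cf; apply/continuous_in_set/continuous_rV. Qed.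

End cube.
Arguments cube : clear implicits.
Arguments cube_boundary : clear implicits.

Section clamp.
Context {R : realType}.
Implicit Types r : R.

Definition clamp r : R := Num.max 0 (Num.min r 1).

Lemma clamp_itv r : 0 <= clamp r <= 1.
Proof. by rewrite /clamp le_max lexx /= ge_max ler01 ge_min lexx orbT. Qed.

Lemma clamp_id r : 0 <= r <= 1 -> clamp r = r.
Proof. by move=> /andP[r0 r1]; rewrite /clamp min_l// max_r. Qed.

Lemma clamp_le0 r : r <= 0 -> clamp r = 0.
Proof. by move=> r0; rewrite /clamp max_l// ge_min r0. Qed.

Lemma clamp_ge1 r : 1 <= r -> clamp r = 1.
Proof. by move=> r1; rewrite /clamp min_r// max_r. Qed.

Lemma continuous_clamp {T : topologicalType} (a : T -> R) :
  continuous a -> continuous (fun x => clamp (a x)).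
Proof.
move=> ca; apply: continuous_maxr; first exact: continuous_const.
by apply: continuous_minr => //; exact: continuous_const.
Qed.

Definition unit_itv : set R := `[0, 1].

Lemma clamp_unit_itv r : clamp r \in unit_itv.
Proof. by apply/mem_set; rewrite /unit_itv /= in_itv /=; exact: clamp_itv. Qed.

Definition clamp_time r : unit_itv := SigSub (clamp_unit_itv r).

Definition time (s : unit_itv) : R := \val s.

Lemma time_itv s : 0 <= time s <= 1.
Proof. by have /set_mem := valP s; rewrite /unit_itv /= in_itv. Qed.

Lemma time_clamp r : time (clamp_time r) = clamp r.
Proof. by []. Qed.

Lemma continuous_time : continuous time.
Proof. exact: continuous_set_val. Qed.

Lemma continuous_clamp_time {T : topologicalType} (a : T -> R) :
  continuous a -> continuous (fun x => clamp_time (a x)).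
Proof. by move=> ca; apply: continuous_in_set; exact: continuous_clamp. Qed.

End clamp.
Arguments unit_itv : clear implicits.

Section update.
Context {R : realType} {n : nat}.
Implicit Types (t : cube R n.+1) (r : R).

Definition upd_row t r : 'rV[R]_n.+1 :=
  \row_i if i == ord0 then clamp r else coord t i.

Lemma upd_row_cube t r : upd_row t r \in cube R n.+1.
Proof.
apply/mem_set => i; rewrite mxE.
by case: ifP => _; [exact: clamp_itv|exact: coord_itv].
Qed.

(* The point of the cube obtained from t by replacing its first coordinate
   by r; r is truncated to [0, 1] only to make the function total. *)
Definition upd t r : cube R n.+1 := SigSub (upd_row_cube t r).

Lemma coord_upd0 t r : coord (upd t r) ord0 = clamp r.
Proof. by rewrite /coord mxE eqxx. Qed.

Lemma coord_upd t r i : i != ord0 -> coord (upd t r) i = coord t i.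
Proof. by rewrite {1}/coord mxE => /negPf ->. Qed.

Lemma upd_upd t r r' : upd (upd t r) r' = upd t r'.
Proof.
apply: cube_eq => i; have [->|i0] := eqVneq i ord0; first by rewrite !coord_upd0.
by rewrite !coord_upd.
Qed.

Lemma upd_coord0 t : upd t (coord t ord0) = t.
Proof.
apply: cube_eq => i; have [->|i0] := eqVneq i ord0.
  by rewrite coord_upd0 clamp_id// coord_itv.
by rewrite coord_upd.
Qed.

Lemma upd_clamp t r : upd t (clamp r) = upd t r.
Proof. by rewrite -(coord_upd0 t r) -[LHS](upd_upd _ r) upd_coord0. Qed.

Lemma continuous_upd {T : topologicalType} (a : T -> cube R n.+1) (b : T -> R) :
  continuous a -> continuous b -> continuous (fun x => upd (a x) (b x)).
Proof.
move=> ca cb; apply: continuous_cube => i; have [->|i0] := eqVneq i ord0.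
  under [X in continuous X]eq_fun do rewrite coord_upd0.
  exact: continuous_clamp.
under [X in continuous X]eq_fun do rewrite coord_upd//.
by apply: (continuous_compose (g := (@coord R n.+1)^~ i)) => //; exact: continuous_coord.
Qed.

Definition on_side t : Prop :=
  exists2 i, i != ord0 & coord t i = 0 \/ coord t i = 1.

Lemma cube_boundaryE t : cube_boundary R n.+1 t <->
  [\/ on_side t, coord t ord0 = 0 | coord t ord0 = 1].
Proof.
split=> [[i ti]|].
  have [i0|i0] := eqVneq i ord0; last by apply: Or31; exists i.
  by move: ti; rewrite i0 => -[ti|ti]; [exact: Or32|exact: Or33].
by move=> [[i _ ti]|t0|t1]; [exists i|exists ord0; left|exists ord0; right].
Qed.

Lemma boundary_upd t r :
  [\/ on_side t, r <= 0 | 1 <= r] -> cube_boundary R n.+1 (upd t r).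
Proof.
move=> tr; apply/cube_boundaryE; rewrite coord_upd0; case: tr => [[i i0 ti]|r0|r1].
- by apply: Or31; exists i => //; rewrite coord_upd.
- by apply: Or32; exact: clamp_le0.
- by apply: Or33; exact: clamp_ge1.
Qed.

End update.

Section loops.
Context (R : realType) (n : nat) (X : topologicalType) (x : X).

Definition loops : set {compact-open, cube R n -> X} :=
  [set f | continuous (f : cube R n -> X) /\
           forall t, cube_boundary R n t -> f t = x].

(* As the type of the elements of a set, it carries the subspace topology. *)
Definition loop_space : Type := loops.
HB.instance Definition _ := Topological.copy loop_space loops.

Definition loop_fun (f : loop_space) : cube R n -> X := \val (f : loops).
Coercion loop_fun : loop_space >-> Funclass.

Lemma continuous_loop (f : loop_space) : continuous f.
Proof. by have /set_mem[] := valP (f : loops). Qed.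

Lemma loop_boundary (f : loop_space) t : cube_boundary R n t -> f t = x.
Proof. by have /set_mem[_] := valP (f : loops); exact. Qed.

Lemma loop_eq (f g : loop_space) : f =1 g -> f = g.
Proof. by move=> fg; apply/val_inj/funext. Qed.

Definition mk_loop (f : cube R n -> X) (cf : continuous f)
    (fx : forall t, cube_boundary R n t -> f t = x) : loop_space :=
  SigSub (mem_set (conj cf fx) : (f : {compact-open, cube R n -> X}) \in loops).

(* The homotopies are relative to the boundary of the cube. *)
Definition homotopic (f g : loop_space) : Prop :=
  exists H : unit_itv R * cube R n -> X,
    [/\ continuous H,
        forall (s : unit_itv R) t, time s = 0 -> H (s, t) = f t,
        forall (s : unit_itv R) t, time s = 1 -> H (s, t) = g t &
        forall s t, cube_boundary R n t -> H (s, t) = x].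

Lemma homotopic_refl f : homotopic f f.
Proof.
exists (fun p => f p.2); split=> //; last by move=> s t; exact: loop_boundary.
by apply: continuous_compose; [exact: continuous_loop|exact: continuous_snd].
Qed.

Let continuous_time_fst :
  continuous (fun p : unit_itv R * cube R n => time p.1).
Proof.
apply: (continuous_compose (g := @time R)); first exact: continuous_time.
exact: continuous_fst.
Qed.

Lemma homotopic_sym f g : homotopic f g -> homotopic g f.
Proof.
move=> [H [cH H0 H1 Hx]]; exists (fun p => H (clamp_time (1 - time p.1), p.2)).
split=> [|s t s0|s t s1|s t]; last exact: Hx.
- apply: (continuous_compose (g := H)) => //; apply: continuous_pair.
    apply: continuous_clamp_time; apply: continuous_subr => //.
    exact: continuous_const.
  exact: continuous_snd.
- by apply: H1; rewrite time_clamp s0 subr0 clamp_ge1.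
- by apply: H0; rewrite time_clamp s1 subrr clamp_le0.
Qed.

Lemma homotopic_trans f g h : homotopic f g -> homotopic g h -> homotopic f h.
Proof.
move=> [H [cH H0 H1 Hx]] [K [cK K0 K1 Kx]].
exists (fun p => if time p.1 <= 2^-1 then H (clamp_time (2 * time p.1), p.2)
                 else K (clamp_time (2 * time p.1 - 1), p.2)).
split=> [|s t s0|s t s1|s t bt] /=.
- apply: continuous_glue => //.
  + apply: (continuous_compose (g := H)) => //; apply: continuous_pair.
      apply: continuous_clamp_time; apply: continuous_mulr => //.
      exact: continuous_const.
    exact: continuous_snd.
  + apply: (continuous_compose (g := K)) => //; apply: continuous_pair.
      apply: continuous_clamp_time; apply: continuous_subr.
        by apply: continuous_mulr => //; exact: continuous_const.
      exact: continuous_const.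
    exact: continuous_snd.
  + move=> p /= ->; rewrite H1 ?K0// time_clamp; [apply: clamp_le0|apply: clamp_ge1]; lra.
- rewrite s0 ifT; last lra.
  by apply: H0; rewrite time_clamp clamp_le0//; lra.
- rewrite s1 ifF; last by apply/negP; lra.
  by apply: K1; rewrite time_clamp clamp_ge1//; lra.
- by case: ifP => _; [exact: Hx|exact: Kx].
Qed.

Definition homotopicb : rel loop_space := fun f g => `[< homotopic f g >].

Lemma homotopicb_refl : reflexive homotopicb.
Proof. by move=> f; apply/asboolP; exact: homotopic_refl. Qed.

Lemma homotopicb_sym : symmetric homotopicb.
Proof.
by move=> f g; apply/asboolP/asboolP; exact: homotopic_sym.
Qed.

Lemma homotopicb_trans : transitive homotopicb.
Proof.
move=> g f h /asboolP fg /asboolP gh; apply/asboolP.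
exact: homotopic_trans fg gh.
Qed.

Definition homotopic_equiv :=
  EquivRel homotopicb homotopicb_refl homotopicb_sym homotopicb_trans.

(* This is a set with a topology for every n; the group structure is
   given below in positive dimensions only, i.e. on pi_qtop R n.+1 x. *)
Definition pi_qtop : Type := quotient_topology {eq_quot homotopic_equiv}.
HB.instance Definition _ := Topological.on pi_qtop.
HB.instance Definition _ := Quotient.on pi_qtop.

Definition homotopy_class (f : loop_space) : pi_qtop := \pi_pi_qtop f.

Lemma homotopy_classP f g : homotopy_class f = homotopy_class g <-> homotopic f g.
Proof.
split=> [/eqmodP/asboolP//|fg]; by apply/eqmodP/asboolP.
Qed.

Lemma homotopy_class_repr (a : pi_qtop) : homotopy_class (repr a) = a.
Proof. exact: reprK. Qed.

End loops.
Arguments loops R n {X} x.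
Arguments loop_space R n {X} x.
Arguments pi_qtop R n {X} x.

Section concatenation.
Context {R : realType} {n : nat} {X : topologicalType} {x : X}.
Local Notation loop := (loop_space R n.+1 x).
Local Notation cube := (cube R n.+1).
Implicit Types (f g h : loop) (t : cube).

Let continuous_coord0 : continuous (fun t => coord t ord0).
Proof. exact: continuous_coord. Qed.

Lemma continuous_loop_upd {T : topologicalType} f (a : T -> cube) (b : T -> R) :
  continuous a -> continuous b -> continuous (fun y => f (upd (a y) (b y))).
Proof.
move=> ca cb; apply: (continuous_compose (g := f)); first exact: continuous_loop.
exact: continuous_upd.
Qed.

Lemma loop_upd f t r : [\/ on_side t, r <= 0 | 1 <= r] -> f (upd t r) = x.
Proof. by move=> tr; apply/loop_boundary/boundary_upd. Qed.

Let continuous_double {T : topologicalType} (a : T -> R) :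
  continuous a -> continuous (fun y => 2 * a y).
Proof. by move=> ca; apply: continuous_mulr => //; exact: continuous_const. Qed.

Let continuous_double1 {T : topologicalType} (a : T -> R) :
  continuous a -> continuous (fun y => 2 * a y - 1).
Proof.
move=> ca; apply: continuous_subr; first exact: continuous_double.
exact: continuous_const.
Qed.

(* Loops are concatenated along the first coordinate of the cube. *)
Definition cat_fun f g t : X :=
  if coord t ord0 <= 2^-1 then f (upd t (2 * coord t ord0))
  else g (upd t (2 * coord t ord0 - 1)).

Lemma continuous_cat f g : continuous (cat_fun f g).
Proof.
apply: continuous_glue => //.
- by apply: continuous_loop_upd; [exact: continuous_idfun|exact: continuous_double].
- by apply: continuous_loop_upd; [exact: continuous_idfun|exact: continuous_double1].
- move=> t t2; rewrite !loop_upd// t2.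
    by apply: Or32; lra.
  by apply: Or33; lra.
Qed.

Lemma cat_boundary f g t : cube_boundary R n.+1 t -> cat_fun f g t = x.
Proof.
rewrite /cat_fun => /cube_boundaryE[ti|t0|t1].
- by case: ifP => _; apply: loop_upd; exact: Or31.
- by rewrite t0 ifT; [apply: loop_upd; apply: Or32; lra|lra].
- by rewrite t1 ifF; [apply: loop_upd; apply: Or33; lra|apply/negP; lra].
Qed.

Definition loop_cat f g : loop := mk_loop (@continuous_cat f g) (@cat_boundary f g).

Lemma continuous_cst_loop : continuous (fun _ : cube => x).
Proof. exact: continuous_const. Qed.

Definition loop_cst : loop := mk_loop (@continuous_cst_loop) (fun _ _ => erefl).

Definition inv_fun f t : X := f (upd t (1 - coord t ord0)).

Lemma continuous_inv f : continuous (inv_fun f).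
Proof.
apply: continuous_loop_upd; first exact: continuous_idfun.
apply: continuous_subr => //.
exact: continuous_const.
Qed.

Lemma inv_boundary f t : cube_boundary R n.+1 t -> inv_fun f t = x.
Proof.
move=> /cube_boundaryE[ti|t0|t1]; apply: loop_upd; first exact: Or31.
- by apply: Or33; lra.
- by apply: Or32; lra.
Qed.

Definition loop_inv f : loop := mk_loop (@continuous_inv f) (@inv_boundary f).

Lemma homotopic_cat f f' g g' : homotopic f f' -> homotopic g g' ->
  homotopic (loop_cat f g) (loop_cat f' g').
Proof.
move=> [H [cH H0 H1 Hx]] [K [cK K0 K1 Kx]].
have ct : continuous (fun p : unit_itv R * cube => coord p.2 ord0).
  apply: (continuous_compose (g := fun t : cube => coord t ord0)) => //.
  exact: continuous_snd.
exists (fun p => if coord p.2 ord0 <= 2^-1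
                 then H (p.1, upd p.2 (2 * coord p.2 ord0))
                 else K (p.1, upd p.2 (2 * coord p.2 ord0 - 1))).
split=> [|s t s0|s t s1|s t /cube_boundaryE[ti|t0|t1]] /=.
- apply: continuous_glue => //.
  + apply: (continuous_compose (g := H)) => //; apply: continuous_pair.
      exact: continuous_fst.
    by apply: continuous_upd; [exact: continuous_snd|exact: (continuous_double ct)].
  + apply: (continuous_compose (g := K)) => //; apply: continuous_pair.
      exact: continuous_fst.
    by apply: continuous_upd; [exact: continuous_snd|exact: (continuous_double1 ct)].
  + move=> p p2; rewrite Hx ?Kx//; apply: boundary_upd; rewrite p2.
      by apply: Or32; lra.
    by apply: Or33; lra.
- by rewrite H0// K0.
- by rewrite H1// K1.
- by case: ifP => _; [apply: Hx|apply: Kx]; apply: boundary_upd; exact: Or31.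
- rewrite t0 ifT; last lra.
  by apply/Hx/boundary_upd/Or32; lra.
- rewrite t1 ifF; last by apply/negP; lra.
  by apply/Kx/boundary_upd/Or33; lra.
Qed.

Lemma homotopic_inv f g : homotopic f g -> homotopic (loop_inv f) (loop_inv g).
Proof.
move=> [H [cH H0 H1 Hx]].
exists (fun p => H (p.1, upd p.2 (1 - coord p.2 ord0))).
split=> [|s t s0|s t s1|s t bt] /=.
- apply: (continuous_compose (g := H)) => //; apply: continuous_pair.
    exact: continuous_fst.
  apply: continuous_upd; first exact: continuous_snd.
  apply: continuous_subr; first exact: continuous_const.
  apply: (continuous_compose (g := fun t : cube => coord t ord0)) => //.
  exact: continuous_snd.
- by rewrite H0.
- by rewrite H1.
- apply/Hx/boundary_upd; move: bt => /cube_boundaryE[ti|t0|t1].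
  + exact: Or31.
  + by apply: Or33; lra.
  + by apply: Or32; lra.
Qed.

Lemma homotopic_reparam f g h (phi psi : R -> R) :
  continuous phi -> continuous psi ->
  (phi 0 <= 0 /\ psi 0 <= 0) \/ (1 <= phi 0 /\ 1 <= psi 0) ->
  (phi 1 <= 0 /\ psi 1 <= 0) \/ (1 <= phi 1 /\ 1 <= psi 1) ->
  (forall t, g t = f (upd t (phi (coord t ord0)))) ->
  (forall t, h t = f (upd t (psi (coord t ord0)))) ->
  homotopic g h.
Proof.
move=> cphi cpsi e0 e1 gE hE.
have ct : continuous (fun p : unit_itv R * cube => coord p.2 ord0).
  apply: (continuous_compose (g := fun t : cube => coord t ord0)) => //.
  exact: continuous_snd.
have cs : continuous (fun p : unit_itv R * cube => time p.1).
  apply: (continuous_compose (g := @time R)); first exact: continuous_time.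
  exact: continuous_fst.
have mid (s : unit_itv R) (u : R) :
    (phi u <= 0 /\ psi u <= 0) \/ (1 <= phi u /\ 1 <= psi u) ->
    (1 - time s) * phi u + time s * psi u <= 0 \/
    1 <= (1 - time s) * phi u + time s * psi u.
  have /andP[s0 s1] := time_itv s.
  by move=> [[a b]|[a b]]; [left|right]; nra.
exists (fun p => f (upd p.2 ((1 - time p.1) * phi (coord p.2 ord0) +
                             time p.1 * psi (coord p.2 ord0)))).
split=> [|s t s0|s t s1|s t bt] /=.
- apply: continuous_loop_upd; first exact: continuous_snd.
  apply: continuous_addr; apply: continuous_mulr => //.
  + by apply: continuous_subr => //; exact: continuous_const.
  + exact: (continuous_compose (g := phi)).
  + exact: (continuous_compose (g := psi)).
- by rewrite s0 subr0 mul1r mul0r addr0 gE.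
- by rewrite s1 subrr mul1r mul0r add0r hE.
- apply: loop_upd; move: bt => /cube_boundaryE[ti|->|->]; first exact: Or31.
  + by have [] := mid s 0 e0; [exact: Or32|exact: Or33].
  + by have [] := mid s 1 e1; [exact: Or32|exact: Or33].
Qed.

Lemma catE f g t : loop_cat f g t =
  if coord t ord0 <= 2^-1 then f (upd t (2 * coord t ord0))
  else g (upd t (2 * coord t ord0 - 1)).
Proof. by []. Qed.

Lemma cat_upd f g t r : 0 <= r <= 1 -> loop_cat f g (upd t r) =
  if r <= 2^-1 then f (upd t (2 * r)) else g (upd t (2 * r - 1)).
Proof. by move=> r01; rewrite catE coord_upd0 clamp_id// !upd_upd. Qed.

Lemma invE f t : loop_inv f t = f (upd t (1 - coord t ord0)).
Proof. by []. Qed.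

Lemma inv_upd f t r : 0 <= r <= 1 -> loop_inv f (upd t r) = f (upd t (1 - r)).
Proof. by move=> r01; rewrite invE coord_upd0 clamp_id// upd_upd. Qed.

Lemma cstE t : loop_cst t = x.
Proof. by []. Qed.

Let cR : continuous (fun r : R => r) := @continuous_idfun R.

Lemma cat_cstr f : homotopic (loop_cat f loop_cst) f.
Proof.
apply: (@homotopic_reparam f _ _ (fun u => 2 * u) (fun u => u)).
- exact: (continuous_double cR).
- exact: cR.
- by left; lra.
- by right; lra.
- move=> t; rewrite catE cstE; case: ifP => // /negbT t2.
  by rewrite loop_upd//; apply: Or33; lra.
- by move=> t; rewrite upd_coord0.
Qed.

Lemma cat_cstl f : homotopic (loop_cat loop_cst f) f.
Proof.
apply: (@homotopic_reparam f _ _ (fun u => 2 * u - 1) (fun u => u)).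
- exact: (continuous_double1 cR).
- exact: cR.
- by left; lra.
- by right; lra.
- move=> t; rewrite catE cstE; case: ifP => // t2.
  by rewrite loop_upd//; apply: Or32; lra.
- by move=> t; rewrite upd_coord0.
Qed.

Lemma cat_invr f : homotopic (loop_cat f (loop_inv f)) loop_cst.
Proof.
apply: (@homotopic_reparam f _ _
  (fun u => Num.min (2 * u) (2 - 2 * u)) (fun=> 0)).
- apply: continuous_minr; first exact: (continuous_double cR).
  apply: continuous_subr; first exact: continuous_const.
  exact: (continuous_double cR).
- exact: continuous_const.
- by left; rewrite ge_min; split=> //; apply/orP; left; lra.
- by left; rewrite ge_min; split=> //; apply/orP; right; lra.
- move=> t; have /andP[t0 t1] := coord_itv t ord0.
  rewrite catE; case: ifPn => t2; first by rewrite min_l//; lra.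
  rewrite inv_upd ?min_r; first by congr (f (upd t _)); lra.
    by lra.
  by apply/andP; split; lra.
- by move=> t; rewrite cstE loop_upd//; exact: Or32.
Qed.

Lemma cat_invl f : homotopic (loop_cat (loop_inv f) f) loop_cst.
Proof.
apply: (@homotopic_reparam f _ _
  (fun u => Num.max (1 - 2 * u) (2 * u - 1)) (fun=> 1)).
- apply: continuous_maxr; last exact: (continuous_double1 cR).
  apply: continuous_subr; first exact: continuous_const.
  exact: (continuous_double cR).
- exact: continuous_const.
- by right; rewrite le_max; split=> //; apply/orP; left; lra.
- by right; rewrite le_max; split=> //; apply/orP; right; lra.
- move=> t; have /andP[t0 t1] := coord_itv t ord0.
  rewrite catE; case: ifPn => t2; last by rewrite max_r//; lra.
  rewrite inv_upd ?max_l//; first by lra.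
  by apply/andP; split; lra.
- by move=> t; rewrite cstE loop_upd//; exact: Or33.
Qed.

Lemma cat_assoc f g h :
  homotopic (loop_cat f (loop_cat g h)) (loop_cat (loop_cat f g) h).
Proof.
apply: (@homotopic_reparam (loop_cat (loop_cat f g) h) _ _
  (fun u => Num.max (2^-1 * u) (Num.max (u - 4^-1) (2 * u - 1))) (fun u => u)).
- apply: continuous_maxr.
    by apply: continuous_mulr; [exact: continuous_const|exact: cR].
  apply: continuous_maxr; last exact: (continuous_double1 cR).
  by apply: continuous_subr; [exact: cR|exact: continuous_const].
- exact: cR.
- by left; rewrite !ge_max; split=> //; apply/and3P; split; lra.
- by right; rewrite !le_max; split=> //; apply/or3P; apply: Or33; lra.
- move=> t; have /andP[t0 t1] := coord_itv t ord0.
  rewrite catE; move: (coord t ord0) t0 t1 => u u0 u1.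
  case: ifPn => [u2|/negP u2].
    rewrite max_l; last by rewrite ge_max; apply/andP; split; lra.
    rewrite cat_upd; last by apply/andP; split; lra.
    rewrite ifT; last by lra.
    rewrite cat_upd; last by apply/andP; split; lra.
    rewrite ifT; last by lra.
    by congr (f (upd t _)); lra.
  rewrite cat_upd; last by apply/andP; split; lra.
  case: ifPn => [u3|/negP u3].
    rewrite max_r; last by rewrite le_max; apply/orP; left; lra.
    rewrite max_l; last by lra.
    rewrite cat_upd; last by apply/andP; split; lra.
    rewrite ifT; last by lra.
    rewrite cat_upd; last by apply/andP; split; lra.
    rewrite ifF; last by apply/negP; lra.
    by congr (g (upd t _)); lra.
  rewrite max_r; last by rewrite le_max; apply/orP; right; lra.
  rewrite max_r; last by lra.
  rewrite cat_upd; last by apply/andP; split; lra.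
  rewrite ifF; last by apply/negP; lra.
  by congr (h (upd t _)); lra.
- by move=> t; rewrite upd_coord0.
Qed.

End concatenation.

Section homotopy_group.
Context {R : realType} {n : nat} {X : topologicalType} {x : X}.
Local Notation pi := (pi_qtop R n.+1 x).
Local Notation cls := (@homotopy_class R n.+1 X x).
Implicit Types a b c : pi.

Definition pi_mul a b : pi := cls (loop_cat (repr a) (repr b)).
Definition pi_one : pi := cls loop_cst.
Definition pi_inv a : pi := cls (loop_inv (repr a)).

Lemma pi_ind (P : pi -> Prop) : (forall f, P (cls f)) -> forall a, P a.
Proof. by move=> Pf a; rewrite -(homotopy_class_repr a). Qed.

Lemma homotopic_repr f : homotopic (repr (cls f)) f.
Proof. by apply/homotopy_classP; rewrite homotopy_class_repr. Qed.

Lemma pi_mulE f g : pi_mul (cls f) (cls g) = cls (loop_cat f g).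
Proof. by apply/homotopy_classP/homotopic_cat; exact: homotopic_repr. Qed.

Lemma pi_invE f : pi_inv (cls f) = cls (loop_inv f).
Proof. by apply/homotopy_classP/homotopic_inv; exact: homotopic_repr. Qed.

Lemma pi_mulgA : associative pi_mul.
Proof.
elim/pi_ind => f; elim/pi_ind => g; elim/pi_ind => h.
by rewrite !pi_mulE; apply/homotopy_classP/cat_assoc.
Qed.

Lemma pi_mul1g : left_id pi_one pi_mul.
Proof.
by elim/pi_ind => f; rewrite pi_mulE; apply/homotopy_classP/cat_cstl.
Qed.

Lemma pi_mulg1 : right_id pi_one pi_mul.
Proof.
by elim/pi_ind => f; rewrite pi_mulE; apply/homotopy_classP/cat_cstr.
Qed.

Lemma pi_mulVg : left_inverse pi_one pi_inv pi_mul.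
Proof.
by elim/pi_ind => f; rewrite pi_invE pi_mulE; apply/homotopy_classP/cat_invl.
Qed.

Lemma pi_mulgV : right_inverse pi_one pi_inv pi_mul.
Proof.
by elim/pi_ind => f; rewrite pi_invE pi_mulE; apply/homotopy_classP/cat_invr.
Qed.

HB.instance Definition _ := isGroup.Build pi
  pi_mulgA pi_mul1g pi_mulg1 pi_mulVg pi_mulgV.

Lemma homotopy_classM :
  {morph cls : f g / loop_cat f g >-> (f * g)%g}.
Proof. by move=> f g; rewrite -pi_mulE. Qed.

Lemma homotopy_classV : {morph cls : f / loop_inv f >-> (f^-1)%g}.
Proof. by move=> f; rewrite -pi_invE. Qed.

Lemma homotopy_class1 : cls loop_cst = 1%g.
Proof. by []. Qed.

End homotopy_group.

(* Main.v *)
Require Import Defs.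
From HB Require Import structures.
From mathcomp Require Import all_boot order ssralg ssrnum interval matrix lra.
From mathcomp Require Import all_classical reals topology normedtype.
Import Order.TTheory GRing.Theory Num.Theory.
Import numFieldNormedType.Exports.

Set Implicit Arguments.
Unset Strict Implicit.
Unset Printing Implicit Defensive.

Local Open Scope classical_set_scope.

(** Loops and homotopies in a product are families of loops and homotopies in
the factors, so the comparison map from the homotopy group of the product to
the product of the homotopy groups is a group isomorphism, and it is clearly
continuous.  Its inverse lifts to a continuous map from the product of the
loop spaces to the loop space of the product (continuous_loop_tuple), and
likewise multiplication in a homotopy group lifts to concatenation of loops.
To conclude one needs the product of the quotient maps from loops to classes
to be again a quotient map; products of quotient maps are not quotient maps
in general, and this is where the countability hypotheses enter.

Following Michael, one works with bi-quotient maps, which are quotient maps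
(biquotient_descend) and, unlike these, are stable under arbitrary products
(biquotient_pair, biquotient_prod).  A quotient map from a second countable
space onto a second countable Hausdorff space is bi-quotient
(quotient_biquotient): if a point of the target were badly covered, a diagonal
argument would produce a sequence of other points that converges to it and has
a closed range, since its preimage is closed.

The loop space of a second countable space is second countable
(loop_space_second_countable), because the cube is compact and second
countable, so the theorem applies to the map from loops to classes.
Continuity into a loop space is always checked by uncurrying:
the cube is compact and regular, so evaluation is jointly continuous
(continuous_eval), and a map into the loop space is continuous as soon as the
map of two variables that it defines is (continuous_to_loop). *)

(** * Bi-quotient maps *)

Lemma near_lt {T : Type} (F : set_system T) (P : nat -> set T) (m : nat) :
  Filter F -> (forall k, (k < m)%N -> F (P k)) ->
  F [set x | forall k, (k < m)%N -> P k x].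
Proof.
move=> FF FP; have : F [set x | forall k : 'I_m, P k x].
  by apply: filter_forall => k; exact: FP.
by apply: filterS => x Px k km; exact: (Px (Ordinal km)).
Qed.

(** The basis is indexed by all natural numbers; indices outside the range of
the given injection contribute the empty set. *)
Lemma second_countable_seq {T : topologicalType} : @second_countable T ->
  exists O : nat -> set T, (forall k, open (O k)) /\
    forall a V, nbhs a V -> exists2 k, O k a & O k `<=` V.
Proof.
move=> [B /countable_injP[c cinj] [Bo Bb]].
exists (fun k => \bigcup_(U in [set U | B U /\ c U = k]) U); split=> [k|a V].
  by apply: bigcup_open => U [BU _]; exact: Bo.
move=> /Bb[U [BU Ua] UV]; exists (c U); first by exists U.
by move=> y [W [BW WU] Wy]; apply: UV; rewrite -(cinj W U)//; exact: mem_set.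
Qed.

(** Michael's bi-quotient maps, in terms of ultrafilters: a limit of G lifts to a
point near which every neighbourhood has a G-large image.  This form makes
stability under products a matter of intersecting large sets. *)
Definition biquotient {T U : topologicalType} (f : T -> U) : Prop :=
  forall (b : U) (G : set_system U), UltraFilter G -> G --> b ->
  exists2 a, f a = b & forall V, nbhs a V -> G (f @` V).

Lemma biquotient_surj {T U : topologicalType} (f : T -> U) b :
  biquotient f -> exists a, f a = b.
Proof.
move=> bf; have [G [GU bG]] := ultraFilterLemma (nbhs_pfilter b).
by have [a fab _] := bf b G GU bG; exists a.
Qed.

(** If g were discontinuous at b, some ultrafilter converging to b would avoid the
preimage of a neighbourhood of g b; but it contains the image of a
neighbourhood, on which g is under control, of a lift of b. *)
Lemma biquotient_descend {T U W : topologicalType} (f : T -> U) (g : U -> W) :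
  biquotient f -> continuous (fun a => g (f a)) -> continuous g.
Proof.
move=> bf cgf b N Nb; apply: contrapT => nN.
have FF : ProperFilter (within (~` (g @^-1` N)) (nbhs b)).
  apply: (Build_ProperFilter_ex _ (within_filter _ (nbhs_filter b))).
  move=> A; rewrite /within /= => FA; apply: contrapT => nA; apply: nN.
  rewrite /= nbhs_simpl; apply: filterS FA => y Ay; apply: contrapT => yN.
  by apply: nA; exists y; exact: Ay.
have [G [GU FG]] := ultraFilterLemma FF.
have GN : G (~` (g @^-1` N)) by apply: FG; exact: withinT.
have Gb : G --> b by move=> A bA; apply: FG; apply: filterS bA => y Ay _.
have [a fa aV] := bf b G GU Gb.
have GfN : G (f @` ((fun a => g (f a)) @^-1` N)).
  by apply: aV; apply: cgf; rewrite fa.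
have [y [gy [a' Na' a'y]]] := filter_ex (filterI GN GfN).
by apply: gy; rewrite -a'y.
Qed.

(** Suppose that no point over b lifts the limit of G.  Then countably many basic
open sets with G-small image (the bad ones) cover the fibre of b.  Since G is an
ultrafilter converging to b, there are points s n that converge to b while s n
avoids the image of the bad sets of index less than n.  Each point of the source
has a neighbourhood that meets the fibres of only finitely many s n: a bad set
over b, and by separation elsewhere.  So the preimage of the set of those s n
with n large enough to have s n != b is closed; as f is a quotient map, this set
is itself closed, against the convergence of s to b. *)
Lemma quotient_biquotient {T U : topologicalType} (f : T -> U) :
  @second_countable T -> @second_countable U -> hausdorff_space U ->
  continuous f -> (forall b, exists a, f a = b) ->
  (forall S, open (f @^-1` S) -> open S) -> biquotient f.
Proof.
move=> /second_countable_seq[O [Oo Ob]] /second_countable_seq[Q [Qo Qb]] T2.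
move=> cf fs fq b G GU Gb; apply: contrapT => nfib.
pose Bad k := ~ G (f @` O k).
have bad a : f a = b -> exists2 k, O k a & Bad k.
  move=> fab; apply: contrapT => nk; apply: nfib; exists a => // V aV.
  have [k Oka OkV] := Ob _ _ aV; apply: contrapT => nV; apply: nk.
  exists k => // GO; apply: nV; apply: filterS GO; exact: image_subset.
pose W n : set U := [set y | forall k, (k < n)%N -> Q k b -> Q k y].
have nbW n : nbhs b (W n).
  apply: near_lt => k kn; have [Qkb|nQ] := pselect (Q k b).
    by apply: filterS (open_nbhs_nbhs (conj (Qo k) Qkb)) => y.
  by apply: nearW => y /nQ.
have base V : nbhs b V -> exists m, forall n y, (m <= n)%N -> W n y -> V y.
  move=> /Qb[k Qkb QkV]; exists k.+1 => n y kn Wny.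
  by apply: QkV; exact: Wny.
have /choice[s sP] n : exists y, W n y /\
    forall k, (k < n)%N -> Bad k -> ~ (f @` O k) y.
  apply: (@filter_ex _ G); apply: filterI; first exact: Gb.
  apply: near_lt => k kn; have [Bk|nB] := pselect (Bad k); last by apply: nearW.
  have [//|] := in_ultra_setVsetC (f @` O k) GU.
  by apply: filterS => y.
(* A bad set around a point over b has an image containing b, so the later s n
   differ from b. *)
have [a0 fa0] := fs b; have [k0 Oa0 Bk0] := bad a0 fa0.
have sb n : (k0 < n)%N -> s n <> b.
  by move=> kn snb; apply: (sP n).2 _ kn Bk0 _; rewrite snb; exists a0.
pose S := [set y | exists2 n, (k0 < n)%N & s n = y].
have sep (a : T) : exists m, \forall a' \near a,
    forall n, (m <= n)%N -> f a' <> s n.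
  have [fab|fab] := pselect (f a = b).
    have [k Oka Bk] := bad a fab; exists k.+1.
    apply: filterS (open_nbhs_nbhs (conj (Oo k) Oka)) => a' Oa' n kn fs'.
    by apply: (sP n).2 _ kn Bk _; rewrite -fs'; exists a'.
  move: T2; rewrite open_hausdorff => /(_ (f a) b).
  case=> [|[A B] /= [/set_mem Aa /set_mem Bb] [oA oB /eqP AB0]].
    exact/eqP.
  have [m mB] := base B (open_nbhs_nbhs (conj oB Bb)); exists m.
  have : nbhs a (f @^-1` A) by apply: cf; exact: open_nbhs_nbhs.
  apply: filterS => a' Aa' n mn fs'.
  suff : (A `&` B) (s n) by rewrite AB0.
  by split; [rewrite -fs'|exact: mB _ _ mn (sP n).1].
have oS : open (~` S).
  apply: fq; rewrite openE => a Sa; have [m mP] := sep a.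
  have near_ne n : (k0 < n)%N -> nbhs a [set a' | f a' <> s n].
    move=> kn; have cl := accessible_closed_set1 (hausdorff_accessible T2).
    apply: (cf a (~` [set s n])); apply: open_nbhs_nbhs; split.
      exact: closed_openC.
    by move=> fas; apply: Sa; exists n.
  have near_small : nbhs a
      [set a' | forall n, (n < m)%N -> (k0 < n)%N -> f a' <> s n].
    apply: near_lt => n _; have [kn|kn] := ltnP k0 n.
      by apply: filterS (near_ne _ kn) => a'.
    by apply: nearW => a'.
  apply: filterS2 near_small mP => a' Ha' Hm [n kn sn].
  have [nm|nm] := ltnP n m; first exact: (Ha' n nm kn).
  exact: (Hm n nm).
have Sb : (~` S) b by move=> [n kn snb]; exact: (sb n kn).
have [m mS] := base (~` S) (open_nbhs_nbhs (conj oS Sb)).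
have kM : (k0 < maxn k0.+1 m)%N by rewrite leq_max leqnn.
apply: (mS (maxn k0.+1 m) (s (maxn k0.+1 m))); first by rewrite leq_maxr.
  exact: (sP _).1.
by exists (maxn k0.+1 m).
Qed.

Lemma ultra_fmap {T U : Type} (f : T -> U) (G : set_system T) :
  UltraFilter G -> UltraFilter (f @ G).
Proof.
move=> GU; split=> [|H HF GH]; first exact: (fmap_proper_filter f ultra_proper).
rewrite eqEsubset; split=> // A HA.
have [//|GA] := in_ultra_setVsetC (f @^-1` A) GU.
by have [y []] := filter_ex (filterI HA (GH (~` A) GA)).
Qed.

Lemma biquotient_pair {T1 T2 U1 U2 : topologicalType} (f : T1 -> U1)
    (g : T2 -> U2) :
  biquotient f -> biquotient g -> biquotient (fun p => (f p.1, g p.2)).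
Proof.
move=> bf bg [b1 b2] G GU Gb.
have [a1 fa1 G1] := bf b1 _ (ultra_fmap fst GU)
  (cvg_trans (cvg_app fst Gb) (@cvg_fst _ _ (nbhs b1) (nbhs b2) _)).
have [a2 ga2 G2] := bg b2 _ (ultra_fmap snd GU)
  (cvg_trans (cvg_app snd Gb) (@cvg_snd _ _ (nbhs b1) (nbhs b2) _)).
exists (a1, a2); first by rewrite /= fa1 ga2.
move=> V [[V1 V2] /= [aV1 aV2] V12].
have G1V : G [set y | (f @` V1) y.1] := G1 _ aV1.
have G2V : G [set y | (g @` V2) y.2] := G2 _ aV2.
apply: filterS2 G1V G2V.
by move=> [y1 y2] /= [c1 ? <-] [c2 ? <-]; exists (c1, c2) => //; exact: V12.
Qed.

Lemma filter_In {T J : Type} (F : set_system T) (P : J -> set T) (s : seq J) :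
  Filter F -> (forall j, List.In j s -> F (P j)) ->
  F [set x | forall j, List.In j s -> P j x].
Proof.
move=> FF; elim: s => [_|j s IHs FP]; first by apply: filterE => x j [].
have Fs := IHs (fun k ks => FP k (or_intror ks)).
apply: filterS2 (FP j (or_introl erefl)) Fs => x Pjx Psx k [<-//|].
exact: Psx.
Qed.

Section product.
Context {I : Type}.

Lemma continuous_proj (T : I -> topologicalType) i :
  continuous (fun a : prod_topology T => a i).
Proof.
move=> a; have /cvg_sup/(_ i) ai : nbhs a --> a by [].
apply: cvg_trans (@initial_continuous _ _ (fun f : prod_topology T => f i) a).
exact: cvg_app.
Qed.

Lemma cvg_prod_topology (T : I -> topologicalType)
    (F : set_system (prod_topology T)) (a : prod_topology T) :
  Filter F ->
  (forall i, (fun b : prod_topology T => b i) @ F --> a i) -> F --> a.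
Proof.
move=> FF Fa; apply/cvg_sup => i V [_ [[W oW <-] Wa] WV].
by apply: filterS WV _; apply: Fa; exact: open_nbhs_nbhs.
Qed.

Lemma continuous_prod_topology {U : topologicalType} (T : I -> topologicalType)
    (f : U -> prod_topology T) :
  (forall i, continuous (fun u => f u i)) -> continuous f.
Proof. by move=> cf u; apply: cvg_prod_topology => i; exact: cf. Qed.

(** The filter of boxes with finitely many proper sides.  The list B.2 bounds the
set of proper sides, so that finiteness makes sense without deciding equality
on I. *)
Definition boxes (T : I -> topologicalType) (a : prod_topology T) :
    set_system (prod_topology T) :=
  filter_from [set B : (forall i, set (T i)) * seq I |
      (forall i, nbhs (a i) (B.1 i)) /\
      (forall i, B.1 i = setT \/ List.In i B.2)]
    (fun B => [set b | forall i, B.1 i (b i)]).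

Lemma boxes_filter (T : I -> topologicalType) (a : prod_topology T) :
  Filter (boxes a).
Proof.
apply: filter_from_filter.
  by exists (fun=> setT, [::]); split=> i; [exact: filterT|left].
move=> [B s] [C t] /= [aB sB] [aC sC].
exists (fun i => B i `&` C i, s ++ t); last first.
  by move=> b BCb; split=> i; have [] := BCb i.
split=> i /=; first exact: filterI.
case: (sB i) => [->|si]; last by right; apply/List.in_or_app; left.
case: (sC i) => [->|ti]; last by right; apply/List.in_or_app; right.
by left; rewrite setIT.
Qed.

(** The product topology is initial for the projections, so it is enough that
boxes refine the preimages of neighbourhoods under each of them. *)
Lemma nbhs_boxes (T : I -> topologicalType) (a : prod_topology T) :
  nbhs a `<=` boxes a.
Proof.
apply: (@cvg_prod_topology T _ a (boxes_filter a)) => i W aW.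
(* The i-th side is W, transported along equalities of indices; the others are
   full. *)
pose B j : set (T j) := [set y | forall e : j = i, W (ecast k (T k) e y)].
exists (B, [:: i]); last by move=> b /(_ i)/(_ erefl).
split=> j /=; have [e|e] := pselect (j = i).
- subst i; apply: filterS aW => y Wy e.
  by rewrite (Prop_irrelevance e erefl).
- by apply: nearW => y f.
- by right; left.
- by left; rewrite eqEsubset; split=> // y _ f.
Qed.

(** The limit is lifted in each coordinate.  The image of a box is the box of the
images of its sides by surjectivity, so it is the intersection of the finitely
many G-large sets given by the proper sides. *)
Lemma biquotient_prod (T U : I -> topologicalType)
    (f : forall i, T i -> U i) : (forall i, biquotient (f i)) ->
  biquotient
    (fun a : prod_topology T => (fun i => f i (a i)) : prod_topology U).
Proof.
move=> bf b G GU Gb.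
have fib i : {a | f i a = b i /\
    forall V, nbhs a V -> G [set y | (f i @` V) (y i)]}.
  apply: cid; have [|a fa aV] :=
    bf i (b i) _ (ultra_fmap (fun y : prod_topology U => y i) GU).
    exact: cvg_trans (cvg_app _ Gb) (@continuous_proj U i b).
  by exists a.
exists (fun i => projT1 (fib i)).
  by apply: functional_extensionality_dep => i; have [] := projT2 (fib i).
move=> V /nbhs_boxes[[B s] /= [aB sB] BV].
have : G [set y | forall i, List.In i s -> (f i @` B i) (y i)].
  by apply: filter_In => i _; have [_] := projT2 (fib i); exact.
apply: filterS => y ys.
have pre i : {c | B i c /\ f i c = y i}.
  apply: cid; case: (sB i) => [->|si]; last by have [c] := ys i si; exists c.
  by have [c fc] := biquotient_surj (y i) (bf i); exists c.
exists (fun i => projT1 (pre i)).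
  by apply: BV => i; have [] := projT2 (pre i).
by apply: functional_extensionality_dep => i; have [] := projT2 (pre i).
Qed.

End product.

(** * The topology of loop spaces *)

Lemma compact_set_type {T : topologicalType} (A : set T) :
  compact A -> compact [set: A].
Proof.
move=> cA F FF _.
pose v : A -> T := set_val.
have FA : F (v @^-1` A) by apply: filterE => a; exact: set_valP.
have [p [Ap Fp]] := cA (v @ F) (fmap_proper_filter _ FF) FA.
exists (SigSub (mem_set Ap) : A); split=> // B V FB [_ [[W oW <-] Wp] WV].
have FvB : F (v @^-1` (v @` B)).
  by apply: filterS FB => b Bb; exists b.
have [_ [[b Bb <-] Wb]] := Fp _ _ FvB (open_nbhs_nbhs (conj oW Wp)).
by exists b; split=> //; exact: WV.
Qed.

Section cube_topology.
Local Open Scope ring_scope.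
Context {R : realType} {n : nat}.

Lemma cube_compact : compact [set: cube R n].
Proof.
apply: compact_set_type.
have := @rV_compact R n (fun=> [set` `[(0 : R), 1]]) (fun=> @segment_compact R 0 1).
by congr compact; rewrite eqEsubset; split=> v /= v01 i;
  have := v01 i; rewrite in_itv.
Qed.

Lemma cube_second_countable : @second_countable (cube R n).
Proof.
have c0P : (const_mx 0 : 'rV[R]_n) \in cube R n.
  by apply/mem_set => i; rewrite mxE lexx ler01.
(* Pointing the cube at the origin makes it a pointed pseudometric space. *)
pose T : pseudoMetricType R := set_type (cube R n).
pose P : pseudoPMetricType R :=
  HB.pack (PseudoMetric.sort T) (PseudoMetric.class T)
    (isPointed.Build (PseudoMetric.sort T) (SigSub c0P : cube R n)).
exact: (@compact_second_countable R P cube_compact).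
Qed.

Lemma cube_regular : @regular_space (cube R n).
Proof. exact: uniform_regular. Qed.

Lemma cube_compact_nbhs (t : cube R n) (V : set (cube R n)) : nbhs t V ->
  exists2 K, nbhs t K & compact K /\ K `<=` V.
Proof.
move=> /cube_regular[W tW WV]; exists (closure W).
  exact: filterS (@subset_closure _ W) tW.
split=> //; apply: (subclosed_compact _ cube_compact) => //.
exact: closed_closure.
Qed.

End cube_topology.

Section loop_topology.
Context {R : realType} {n : nat} {X : topologicalType} {x : X}.
Local Notation loop := (loop_space R n x).
Local Notation cube := (cube R n).

Lemma nbhs_loop_sub (f : loop) (K : set cube) (O : set X) :
  compact K -> open O -> f @` K `<=` O ->
  nbhs f [set g : loop | g @` K `<=` O].
Proof.
move=> cK oO fKO.
apply: (@continuous_set_val _ (loops R n x) f [set g | g @` K `<=` O]).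
by apply: open_nbhs_nbhs; split=> //; exact: compact_open_open.
Qed.

(** The classical exponential law: a point of the cube has arbitrarily small
compact neighbourhoods, and these yield subbasic open sets of loops. *)
Lemma continuous_eval : continuous (fun p : loop * cube => p.1 p.2).
Proof.
move=> [f t] V; rewrite nbhsE => -[O [oO Oft] OV].
have [K tK [cK KO]] : exists2 K, nbhs t K &
    compact K /\ K `<=` loop_fun f @^-1` O.
  apply: cube_compact_nbhs; apply: continuous_loop.
  exact: open_nbhs_nbhs.
exists ([set g : loop | g @` K `<=` O], K); first split=> //=.
  by apply: nbhs_loop_sub => // _ [u Ku <-]; exact: KO.
by move=> [g u] /= [gK Ku]; apply: OV; apply: gK; exists u.
Qed.

(** Continuous convergence implies convergence in the compact-open topology, by
compactness of the tested set. *)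
Lemma cvg_loop (F : set_system loop) (f : loop) : Filter F ->
  (forall t,
    (fun p : loop * cube => p.1 p.2) @ filter_prod F (nbhs t) --> f t) ->
  F --> f.
Proof.
move=> FF Ff V [_ [[W oW <-] Wf] WV].
suff FW : (fun g : loop => \val (g : loops R n x)) @ F -->
    \val (f : loops R n x).
  by apply: filterS WV _; apply: FW; exact: open_nbhs_nbhs.
apply/compact_open_cvgP => K O cK oO fKO.
have : \near F, K `<=` (fun t => O ((F : loop) t)).
  move/compact_near_coveringP: cK; apply=> t Kt.
  have fO : nbhs (f t) O.
    by apply: open_nbhs_nbhs; split=> //; apply: fKO; exists t.
  have [[A B] /= [FA tB] AB] := Ff t O fO.
  by exists (B, A) => // -[u g] /= [Bu Ag]; exact: (AB (g, u)).
by apply: filterS => g KO _ [u Ku <-]; exact: KO.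
Qed.

Lemma continuous_to_loop {U : topologicalType} (phi : U -> loop) :
  continuous (fun p : U * cube => phi p.1 p.2) -> continuous phi.
Proof.
move=> cphi u; apply: cvg_loop => t V Vut.
have [[A B] /= [uA tB] AB] := cphi (u, t) V Vut.
by exists (phi @` A, B) => [|[_ v] /= [[w Aw <-] Bv]];
  [split=> //; apply: filterS uA => w Aw; exists w|exact: (AB (w, v))].
Qed.

(** A countable subbasis is given by the loops that map the closure of D j into
O k, where D and O enumerate bases of the cube and of X; finite intersections
are indexed by lists of pairs (j, k).  The filter of those containing f
converges continuously to f, because the cube is regular. *)
Lemma loop_space_second_countable :
  @second_countable X -> @second_countable loop.
Proof.
move=> /second_countable_seq[O [oO bO]].
have [D [oD bD]] := second_countable_seq (@cube_second_countable R n).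
pose B (s : seq (nat * nat)) : set loop :=
  [set g | forall p, List.In p s -> g @` closure (D p.1) `<=` O p.2].
have cD k : compact (closure (D k)).
  apply: (subclosed_compact _ (@cube_compact R n)) => //.
  exact: closed_closure.
have oB s : open (B s).
  rewrite openE => f Bf; apply: filter_In => p ps.
  by apply: nbhs_loop_sub => //; exact: Bf.
exists (range B).
  apply: card_le_trans (card_image_le _ _) _; exact: countableP.
split=> [_ [s _ <-] //|f].
apply: cvg_loop => [|t V].
  apply: filter_from_filter.
    by exists (B [::]); split; [exists [::]|move=> p []].
  move=> _ _ [[s1 _ <-] B1] [[s2 _ <-] B2]; exists (B (s1 ++ s2)).
    split; first by exists (s1 ++ s2).
    by move=> p /(@List.in_app_or _ _ _ _)[]; [exact: B1|exact: B2].
  by move=> g Bg; split=> p ps; apply: Bg; apply/List.in_or_app; [left|right].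
move=> /bO[k Okf OkV].
have tOk : nbhs t (loop_fun f @^-1` O k).
  by apply: continuous_loop; exact: open_nbhs_nbhs.
have [W tW WOk] := cube_regular tOk; have [j Djt DjW] := bD _ _ tW.
exists (B [:: (j, k)], D j).
  split; last exact: (open_nbhs_nbhs (conj (oD j) Djt)).
  exists (B [:: (j, k)]) => //; split; first by exists [:: (j, k)].
  move=> _ [<-|[]] _ [u Du <-]; apply: WOk; exact: closure_subset Du.
move=> [g u] /= [Bg Du]; apply: OkV; apply: (Bg (j, k)); first by left.
by exists u => //; exact: subset_closure.
Qed.

End loop_topology.

(** * Continuity of the group operations *)

Section loop_operations.
Local Open Scope ring_scope.
Context {R : realType} {n : nat} {X : topologicalType} {x : X}.
Local Notation loop := (loop_space R n.+1 x).
Local Notation cube := (cube R n.+1).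

Lemma continuous_eval_upd {T : topologicalType} (f : T -> loop) (a : T -> cube)
    (b : T -> R) : continuous f -> continuous a -> continuous b ->
  continuous (fun y => f y (upd (a y) (b y))).
Proof.
move=> cf ca cb.
apply: (continuous_compose (g := fun p : loop * cube => p.1 p.2)
  (f := fun y => (f y, upd (a y) (b y)))); first exact: continuous_eval.
by apply: continuous_pair => //; exact: continuous_upd.
Qed.

Let continuous_coord_snd {T : topologicalType} :
  continuous (fun p : T * cube => coord p.2 ord0).
Proof.
apply: (continuous_compose (g := fun t : cube => coord t ord0)).
  exact: continuous_coord.
exact: continuous_snd.
Qed.

Lemma continuous_loop_cat :
  continuous (fun p : loop * loop => loop_cat p.1 p.2).
Proof.
apply: continuous_to_loop.
have cd : continuous (fun p : (loop * loop) * cube => 2 * coord p.2 ord0).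
  apply: continuous_mulr; first exact: continuous_const.
  exact: continuous_coord_snd.
apply: (@continuous_glue R _ _
  (fun p : (loop * loop) * cube => coord p.2 ord0)).
- exact: continuous_coord_snd.
- apply: continuous_eval_upd => //; last exact: continuous_snd.
  by apply: (continuous_compose (g := fst)); exact: continuous_fst.
- apply: continuous_eval_upd; last 2 first.
  + exact: continuous_snd.
  + by apply: continuous_subr => //; exact: continuous_const.
  + apply: (continuous_compose (g := snd)); first exact: continuous_snd.
    exact: continuous_fst.
- move=> p p2; rewrite !loop_upd// p2.
    by apply: Or32; lra.
  by apply: Or33; lra.
Qed.

Lemma continuous_loop_inv : continuous (@loop_inv R n X x).
Proof.
apply: continuous_to_loop; apply: continuous_eval_upd.
- exact: continuous_fst.
- exact: continuous_snd.
- apply: continuous_subr; first exact: continuous_const.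
  exact: continuous_coord_snd.
Qed.

End loop_operations.

Section quotient_map.
Context {R : realType} {n : nat} {X : topologicalType} {x : X}.
Local Notation cls := (@homotopy_class R n X x).

Lemma continuous_homotopy_class : continuous cls.
Proof. exact: pi_continuous. Qed.

Lemma homotopy_class_biquotient : @second_countable X ->
  @second_countable (pi_qtop R n x) -> hausdorff_space (pi_qtop R n x) ->
  biquotient cls.
Proof.
move=> X2 pi2 T2; apply: quotient_biquotient => //.
- exact: loop_space_second_countable.
- exact: continuous_homotopy_class.
- by move=> a; exists (repr a); exact: homotopy_class_repr.
Qed.

End quotient_map.

(** Concatenation is jointly continuous on loops; joint continuity passes to
classes because the product of two bi-quotient maps is bi-quotient. *)
Lemma pi_qtop_topological_group {R : realType} {n : nat} {X : topologicalType}
    {x : X} : biquotient (@homotopy_class R n.+1 X x) ->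
  is_topological_group (pi_qtop R n.+1 x).
Proof.
move=> bq; split.
  apply: (biquotient_descend (biquotient_pair bq bq)) => /=.
  under [X in continuous X]eq_fun do rewrite -homotopy_classM.
  apply: (continuous_compose (g := @homotopy_class R n.+1 X x)).
    exact: continuous_homotopy_class.
  exact: continuous_loop_cat.
apply: (biquotient_descend bq).
under [X in continuous X]eq_fun do rewrite -homotopy_classV.
apply: (continuous_compose (g := @homotopy_class R n.+1 X x)).
  exact: continuous_homotopy_class.
exact: continuous_loop_inv.
Qed.

Lemma prod_topological_group {I : Type} (G : I -> preTopologicalGroupType) :
  (forall i, is_topological_group (G i)) ->
  is_topological_group (prod_topology G).
Proof.
move=> GG; split; apply: continuous_prod_topology => i.
  apply: (continuous_compose (g := fun p : G i * G i => (p.1 * p.2)%g)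
    (f := fun p : prod_topology G * prod_topology G => (p.1 i, p.2 i))).
    exact: (GG i).1.
  by apply: continuous_pair;
    apply: (continuous_compose (@continuous_proj I G i));
    [exact: continuous_fst|exact: continuous_snd].
apply: (continuous_compose (g := fun a : G i => (a^-1)%g)).
  exact: (GG i).2.
exact: continuous_proj.
Qed.

Lemma topological_group_transport (G H : preTopologicalGroupType) :
  topological_group_isomorphic G H -> is_topological_group H ->
  is_topological_group G.
Proof.
move=> [f [g [fM fK gK cf cg]]] [cmul cinv].
have f1 : f 1%g = 1%g by apply: (mulgI (f 1%g)); rewrite -fM !mulg1.
have fV a : f (a^-1)%g = ((f a)^-1)%g.
  by apply: (mulgI (f a)); rewrite -fM !mulgV.
split.
  rewrite (_ : (fun p => _) = fun p : G * G => g (f p.1 * f p.2)%g); last first.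
    by apply/funext => p; rewrite -fM fK.
  apply: (continuous_compose cg).
  apply: (continuous_compose (g := fun p : H * H => (p.1 * p.2)%g)
    (f := fun p : G * G => (f p.1, f p.2))) => //.
  by apply: continuous_pair; apply: (continuous_compose cf);
    [exact: continuous_fst|exact: continuous_snd].
rewrite (_ : (fun a => _) = fun a : G => g ((f a)^-1)%g); last first.
  by apply/funext => a; rewrite -fV fK.
apply: (continuous_compose cg).
exact: (continuous_compose (g := fun a : H => (a^-1)%g)).
Qed.

(** * Loops in a product *)

Section product_of_spaces.
Context {R : realType} {I : Type} {X : I -> topologicalType}.

Section loops.
Context {n : nat} {x : forall i, X i}.
Local Notation loopX := (loop_space R n (x : prod_topology X)).
Local Notation loop i := (loop_space R n (x i)).

Lemma loop_proj_continuous (f : loopX) i : continuous (fun t => f t i).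
Proof.
apply: (continuous_compose (@continuous_proj I X i)); exact: continuous_loop.
Qed.

Lemma loop_proj_boundary (f : loopX) i t : cube_boundary R n t -> f t i = x i.
Proof. by move=> bt; rewrite loop_boundary. Qed.

Definition loop_proj i (f : loopX) : loop i :=
  mk_loop (@loop_proj_continuous f i) (@loop_proj_boundary f i).

Definition tuple_fun (f : prod_topology (fun i => loop i)) t :
    prod_topology X := fun i => f i t.

Lemma loop_tuple_continuous (f : prod_topology (fun i => loop i)) :
  continuous (tuple_fun f).
Proof. by apply: continuous_prod_topology => i; exact: continuous_loop. Qed.

Lemma loop_tuple_boundary (f : prod_topology (fun i => loop i)) t :
  cube_boundary R n t -> tuple_fun f t = x.
Proof.
move=> bt; apply: functional_extensionality_dep => i.
exact: (loop_boundary (f i)).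
Qed.

Definition loop_tuple (f : prod_topology (fun i => loop i)) : loopX :=
  mk_loop (@loop_tuple_continuous f) (@loop_tuple_boundary f).

Lemma continuous_loop_proj i : continuous (loop_proj i).
Proof.
apply: continuous_to_loop.
apply: (continuous_compose (g := fun a : prod_topology X => a i)
  (f := fun p : loopX * cube R n => p.1 p.2)); first exact: continuous_proj.
exact: continuous_eval.
Qed.

Lemma continuous_loop_tuple : continuous loop_tuple.
Proof.
apply: continuous_to_loop; apply: continuous_prod_topology => i.
apply: (continuous_compose (g := fun p : loop i * cube R n => p.1 p.2)
  (f := fun p : prod_topology (fun i => loop i) * cube R n => (p.1 i, p.2))).
  exact: continuous_eval.
apply: continuous_pair; last exact: continuous_snd.
apply: (continuous_compose (@continuous_proj I (fun i => loop i) i)).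
exact: continuous_fst.
Qed.

Lemma homotopic_proj (f g : loopX) i :
  homotopic f g -> homotopic (loop_proj i f) (loop_proj i g).
Proof.
move=> [H [cH H0 H1 Hx]]; exists (fun p => H p i).
split=> [|s t s0|s t s1|s t bt].
- exact: (continuous_compose (@continuous_proj I X i)).
- by rewrite H0.
- by rewrite H1.
- by rewrite Hx.
Qed.

Lemma homotopic_tuple (f g : prod_topology (fun i => loop i)) :
  (forall i, homotopic (f i) (g i)) -> homotopic (loop_tuple f) (loop_tuple g).
Proof.
move=> fg; pose H i := projT1 (cid (fg i)).
exists (fun p => (fun i => H i p) : prod_topology X).
split=> [|s t s0|s t s1|s t bt].
- apply: continuous_prod_topology => i.
  by rewrite /H; case: cid => K [].
- apply: functional_extensionality_dep => i.
  by rewrite /H; case: cid => K [? K0]; rewrite /= K0.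
- apply: functional_extensionality_dep => i.
  by rewrite /H; case: cid => K [? ? K1]; rewrite /= K1.
- apply: functional_extensionality_dep => i.
  by rewrite /H; case: cid => K [? ? ? Kx]; rewrite /= Kx.
Qed.

Lemma loop_tupleK i (f : prod_topology (fun i => loop i)) :
  loop_proj i (loop_tuple f) = f i.
Proof. exact: loop_eq. Qed.

Lemma loop_projK (f : loopX) : loop_tuple (loop_proj^~ f) = f.
Proof. exact: loop_eq. Qed.

End loops.

Context {n : nat} (x : forall i, X i).
Local Notation piX := (pi_qtop R n.+1 (x : prod_topology X)).
Local Notation pi i := (pi_qtop R n.+1 (x i)).
Local Notation Ppi := (prod_topology (fun i => pi i)).

Lemma loop_proj_cat i (f g : loop_space R n.+1 (x : prod_topology X)) :
  loop_proj i (loop_cat f g) = loop_cat (loop_proj i f) (loop_proj i g).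
Proof.
apply: loop_eq => t; rewrite catE.
change (cat_fun f g t i =
  if coord t ord0 <= 2^-1 then f (upd t (2 * coord t ord0)) i
  else g (upd t (2 * coord t ord0 - 1)) i)%R.
by rewrite /cat_fun; case: ifP.
Qed.

Definition pi_proj (a : piX) : Ppi :=
  fun i => homotopy_class (loop_proj i (repr a)).

Definition pi_tuple (b : Ppi) : piX :=
  homotopy_class (loop_tuple (fun i => repr (b i))).

Lemma pi_projE f i :
  pi_proj (homotopy_class f) i = homotopy_class (loop_proj i f).
Proof. apply/homotopy_classP/homotopic_proj; exact: homotopic_repr. Qed.

Lemma pi_tupleE f :
  pi_tuple (fun i => homotopy_class (f i)) = homotopy_class (loop_tuple f).
Proof. by apply/homotopy_classP/homotopic_tuple => i; exact: homotopic_repr. Qed.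

Lemma pi_projM : {morph pi_proj : a b / (a * b)%g >-> (a * b)%g}.
Proof.
apply: (@pi_ind R n _ (x : prod_topology X)) => f.
apply: (@pi_ind R n _ (x : prod_topology X)) => g.
apply: functional_extensionality_dep => i.
rewrite -homotopy_classM pi_projE.
transitivity
  (pi_proj (homotopy_class f) i * pi_proj (homotopy_class g) i)%g => //.
by rewrite !pi_projE -homotopy_classM loop_proj_cat.
Qed.

Lemma pi_projK : cancel pi_proj pi_tuple.
Proof.
apply: (@pi_ind R n _ (x : prod_topology X)) => f.
rewrite [pi_proj _](_ : _ = fun i => homotopy_class (loop_proj i f)).
  by rewrite pi_tupleE loop_projK.
by apply: functional_extensionality_dep => i; exact: pi_projE.
Qed.

Lemma pi_tupleK : cancel pi_tuple pi_proj.
Proof.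
move=> b; apply: functional_extensionality_dep => i.
by rewrite pi_projE loop_tupleK homotopy_class_repr.
Qed.

Lemma continuous_pi_proj : continuous pi_proj.
Proof.
apply: continuous_prod_topology => i; apply/quotient_continuous.
under [X in continuous X]eq_fun do rewrite /= pi_projE.
apply: (continuous_compose (g := @homotopy_class R n.+1 (X i) (x i))).
  exact: continuous_homotopy_class.
exact: continuous_loop_proj.
Qed.

(** On loops the map is loop_tuple; continuity descends along the product of the
maps from loops to classes, which is bi-quotient when each factor is. *)
Lemma continuous_pi_tuple :
  (forall i, biquotient (@homotopy_class R n.+1 (X i) (x i))) ->
  continuous pi_tuple.
Proof.
move=> bq; apply: (biquotient_descend (biquotient_prod bq)).
under [X in continuous X]eq_fun do rewrite pi_tupleE.
apply: (continuous_compose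
  (g := @homotopy_class R n.+1 _ (x : prod_topology X))).
  exact: continuous_homotopy_class.
exact: continuous_loop_tuple.
Qed.

End product_of_spaces.

Theorem corollary2p7 (R : realType) (n : nat) (I : Type)
    (X : I -> topologicalType) (x : forall i, X i)
    (hX : forall i, @second_countable (X i))
    (hpi2 : forall i, @second_countable (pi_qtop R n.+1 (x i)))
    (hpiT2 : forall i, hausdorff_space (pi_qtop R n.+1 (x i))) :
  [/\ is_topological_group (pi_qtop R n.+1 (x : prod_topology X)),
      is_topological_group (prod_topology (fun i => pi_qtop R n.+1 (x i))) &
      topological_group_isomorphic
        (pi_qtop R n.+1 (x : prod_topology X))
        (prod_topology (fun i => pi_qtop R n.+1 (x i)))].
Proof.
have bq i : biquotient (@homotopy_class R n.+1 (X i) (x i)).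
  exact: homotopy_class_biquotient.
have iso : topological_group_isomorphic
    (pi_qtop R n.+1 (x : prod_topology X))
    (prod_topology (fun i => pi_qtop R n.+1 (x i))).
  exists (@pi_proj R I X n x), (@pi_tuple R I X n x); split.
  - exact: pi_projM.
  - exact: pi_projK.
  - exact: pi_tupleK.
  - exact: continuous_pi_proj.
  - exact: continuous_pi_tuple.
have prodG : is_topological_group
    (prod_topology (fun i => pi_qtop R n.+1 (x i))).
  by apply: prod_topological_group => i; exact: pi_qtop_topological_group.
by split=> //; exact: topological_group_transport iso prodG.
Qed.
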